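(* Let $S$ be a semigroup with zero such that $Z(S)\neq S$ and $Z(S)=\mathrm{Nil}(S)\neq\{0\}$. If $|Z(S)^{*}|\geq 2$, then the annihilator digraph $\overrightarrow{\mathrm{AG}}(S)$ is connected and $\mathrm{Diam}(\overrightarrow{\mathrm{AG}}(S))\leq 2$.
   Context: Let $S$ be a semigroup with zero, not necessarily commutative; for $A\subseteq S$, $A^{*}=A\setminus\{0\}$. An element $x\in S$ is a left (resp. right) zero divisor if $xy=0$ (resp. $yx=0$) for some $y\in S^{*}$; $Z(S)$ is the set of all elements that are left or right zero divisors. $\mathrm{Nil}(S)$ is the set of nilpotent elements of $S$. For $x\in S$, $\mathrm{Ann}_{l}(x)=\{s\in S: sx=0\}$ and $\mathrm{Ann}_{r}(x)=\{s\in S: xs=0\}$. The annihilator digraph $\overrightarrow{\mathrm{AG}}(S)$ is the simple digraph (no loops, no multiple arcs) with vertex set $Z(S)^{*}$ in which, for distinct $x,y\in Z(S)^{*}$, $x\to y$ is an arc iff $\mathrm{Ann}_{l}(xy)\setminus(\mathrm{Ann}_{l}(x)\cup\mathrm{Ann}_{l}(y))\neq\emptyset$ or $\mathrm{Ann}_{r}(xy)\setminus(\mathrm{Ann}_{r}(x)\cup\mathrm{Ann}_{r}(y))\neq\emptyset$. A digraph is connected if for every two distinct vertices $x,y$ there is a directed path from $x$ to $y$. The directed distance from $x$ to $y$ is the length of a shortest directed path from $x$ to $y$ ($\infty$ if none exists), and $\mathrm{Diam}$ is the greatest directed distance between vertices. *)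

(* Defs.v *)
From HB Require Import structures.
From mathcomp Require Import all_boot all_order all_algebra.
From mathcomp Require Import all_classical all_reals ereal.

Set Implicit Arguments.
Unset Strict Implicit.
Unset Printing Implicit Defensive.

Local Open Scope classical_set_scope.

Record digraph (T : Type) := Digraph {
  vertices : set T;
  arc : T -> T -> Prop;
  arc_vertices : forall x y, arc x y -> vertices x /\ vertices y;
  arc_irrefl : forall x, ~ arc x x
}.

Section Digraph.
Context {T : eqType} (G : digraph T).
Implicit Types (x y : T) (p : seq T).

(* The path visits x :: p, so its length is size p. *)
Definition is_dipath x y p : Prop :=
  [/\ path (fun u v => `[< arc G u v >]) x p, uniq (x :: p) & last x p = y].

Definition connected_digraph : Prop :=
  forall x y, vertices G x -> vertices G y -> x <> y ->
  exists p, is_dipath x y p.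

(* The infimum of the empty set is +oo, the distance to an unreachable vertex;
   likewise the diameter is +oo when the distances are unbounded. *)
Definition didist (R : realType) x y : \bar R :=
  ereal_inf [set ((size p)%:R%:E)%R | p in is_dipath x y].

Definition Diam (R : realType) : \bar R :=
  ereal_sup [set d | exists x y,
    [/\ vertices G x, vertices G y & d = didist R x y]].

End Digraph.

Section SemigroupWithZero.
Context {S : semigroupType} (zero : S).
Implicit Types (x y s : S) (A : set S).
Local Open Scope group_scope.

Definition is_zero : Prop :=
  left_zero zero *%g /\ right_zero zero *%g.

Definition nonzero A : set S := A `\ zero.

Definition left_zero_divisor x : Prop :=
  exists2 y, nonzero setT y & x * y = zero.

Definition right_zero_divisor x : Prop :=
  exists2 y, nonzero setT y & y * x = zero.

Definition zdiv : set S :=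
  [set x | left_zero_divisor x \/ right_zero_divisor x].

(* For 0 < n, [iterop n *%g x x] is the n-th power of x; a semigroup has no
   unit to serve as the zeroth power. *)
Definition nilset : set S :=
  [set x | exists2 n, (0 < n)%N & iterop n *%g x x = zero].

Definition annl x : set S := [set s | s * x = zero].

Definition annr x : set S := [set s | x * s = zero].

Definition ann_arc x y : Prop :=
  [/\ nonzero zdiv x, nonzero zdiv y, x <> y &
      annl (x * y) `\` (annl x `|` annl y) !=set0 \/
      annr (x * y) `\` (annr x `|` annr y) !=set0].

Lemma ann_arc_vertices x y :
  ann_arc x y -> nonzero zdiv x /\ nonzero zdiv y.
Proof. by case. Qed.

Lemma ann_arc_irrefl x : ~ ann_arc x x.
Proof. by case. Qed.

Definition annihilator_digraph : digraph S :=
  Digraph ann_arc_vertices ann_arc_irrefl.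

End SemigroupWithZero.

(* Main.v *)
Require Import Defs.
From HB Require Import structures.
From mathcomp Require Import all_boot all_order all_algebra.
From mathcomp Require Import all_classical all_reals ereal.

Local Open Scope classical_set_scope.

(** Two facts give paths of length at most 2.

    If [x * y = 0], the annihilators of the product are all of [S]; an element
    [c] that is not a zero divisor lies in neither [Ann_l(x)] nor [Ann_l(y)],
    so there is an arc from [x] to [y] ([ann_arc_mul0]).

    If [x * y <> 0], some [z <> 0] satisfies [x * z = 0] and [z * y = 0]: as
    [x] is nilpotent, the sequence [y], [x y], [x^2 y], ... reaches [0], and
    its last nonzero term [x^k y] is killed by [x] on the left; multiplying
    that term repeatedly by [y] on the right, the last nonzero term
    [z = x^k y y^j] is killed by [y] on the right, and still by [x] on the
    left ([nil_two_sided_killed]).  Such a [z] is neither [x] nor [y], since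
    either equality would give [x * y = 0], so [x -> z -> y] is a path by the
    first fact. *)

Lemma iter_last_neq (T : eqType) (f : T -> T) (a w : T) n :
  w <> a -> iter n f w = a -> exists2 k, iter k f w <> a & f (iter k f w) = a.
Proof.
move=> wa; elim: n => [|n IHn] //= fna.
by have [/IHn//|/eqP] := eqVneq (iter n f w) a; exists n.
Qed.

Section Nilpotent.
Local Set Implicit Arguments.
Local Unset Strict Implicit.
Context {S : semigroupType} {zero : S} (hzero : is_zero zero).
Implicit Types (x y z w : S).
Local Open Scope group_scope.

Lemma iter_mulgl x w n : iter n ( *%g x) x * w = iter n.+1 ( *%g x) w.
Proof. by elim: n => //= n <-; rewrite mulgA. Qed.

Lemma iter_mulgr x w n : w * iter n ( *%g x) x = iter n.+1 ( *%g^~ x) w.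
Proof. by elim: n w => // n IHn w; rewrite iterS mulgA IHn -iterSr. Qed.

Lemma nil_left_killed x w : nilset zero x -> w <> zero ->
  exists2 z, z <> zero & x * z = zero.
Proof.
case=> -[//|n] _; rewrite iteropS => xn0 w0.
have [|k] := @iter_last_neq _ ( *%g x) zero w n.+1 w0; last first.
  by exists (iter k ( *%g x) w).
by rewrite -iter_mulgl xn0 hzero.1.
Qed.

(** Right multiplication can only enlarge the left annihilator, so the
    nonzero element killed by [y] on the right inherits the left annihilator of
    the starting element. *)
Lemma nil_right_killed y w : nilset zero y -> w <> zero ->
  exists z, [/\ z <> zero, z * y = zero & annl zero w `<=` annl zero z].
Proof.
case=> -[//|n] _; rewrite iteropS => yn0 w0.
have [|k z0 zy] := @iter_last_neq _ ( *%g^~ y) zero w n.+1 w0.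
  by rewrite -iter_mulgr yn0 hzero.2.
exists (iter k ( *%g^~ y) w); split=> // s sw0; rewrite /annl /=.
by elim: k {z0 zy} => //= k IHk; rewrite mulgA IHk hzero.1.
Qed.

Lemma nil_two_sided_killed x y : nilset zero x -> nilset zero y ->
  y <> zero -> exists z, [/\ z <> zero, x * z = zero & z * y = zero].
Proof.
move=> nx ny y0; have [w w0 xw] := nil_left_killed nx y0.
by have [z [z0 zy /(_ x xw) xz]] := nil_right_killed ny w0; exists z.
Qed.

Lemma ann_arc_mul0 x y : zdiv zero <> setT ->
  nonzero zero (zdiv zero) x -> nonzero zero (zdiv zero) y ->
  x <> y -> x * y = zero -> ann_arc zero x y.
Proof.
move=> /eqP/setTPn[c cNZ] Zx Zy xy xy0; split=> //; left; exists c; split.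
  by rewrite /annl /= xy0 hzero.2.
by case=> c0; apply: cNZ; left; [exists x => //; have [] := Zx
                                |exists y => //; have [] := Zy].
Qed.

Lemma ann_dipath_le2 x y :
  zdiv zero <> setT -> zdiv zero = nilset zero ->
  nonzero zero (zdiv zero) x -> nonzero zero (zdiv zero) y ->
  exists2 p, is_dipath (annihilator_digraph zero) x y p & (size p <= 2)%N.
Proof.
move=> hZS hZNil Zx Zy.
have [->|/eqP xy] := eqVneq x y; first by exists [::].
have [xy0|/eqP xy0] := eqVneq (x * y) zero.
  exists [:: y] => //; split=> //=; last by rewrite inE andbT; apply/eqP.
  by rewrite andbT; apply/asboolP; apply: ann_arc_mul0.
have [nx ny] : nilset zero x /\ nilset zero y.
  by rewrite -hZNil; split; [case: Zx|case: Zy].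
have [z [z0 xz zy]] := nil_two_sided_killed nx ny Zy.2.
have Zz : nonzero zero (zdiv zero) z.
  by split=> //; right; exists x => //; have [] := Zx.
have xNz : x <> z by move=> xz'; apply: xy0; rewrite xz'.
have zNy : z <> y by move=> zy'; apply: xy0; rewrite -zy'.
exists [:: z; y] => //; split=> //=.
  by rewrite andbT; apply/andP; split; apply/asboolP; apply: ann_arc_mul0.
by rewrite !inE negb_or andbT; apply/andP; split;
  [apply/andP; split|]; apply/eqP.
Qed.

End Nilpotent.

Theorem proposition5p1 (R : realType) (S : semigroupType) (zero : S)
    (hzero : is_zero zero)
    (hZS : zdiv zero <> setT)
    (hZNil : zdiv zero = nilset zero)
    (hNil0 : nilset zero <> [set zero])
    (hcard : (`I_2 #<= nonzero zero (zdiv zero))%card) :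
  connected_digraph (annihilator_digraph zero) /\
  (Diam (annihilator_digraph zero) R <= 2%:R%:E)%E.
Proof.
split=> [x y Zx Zy _|].
  by have [p] := ann_dipath_le2 hzero hZS hZNil Zx Zy; exists p.
apply: ge_ereal_sup => _ [x [y [Zx Zy ->]]].
have [p xpy p2] := ann_dipath_le2 hzero hZS hZNil Zx Zy.
have d2 : ((size p)%:R%:E <= 2%:R%:E :> \bar R)%E.
  by rewrite lee_fin Num.Theory.ler_nat.
by apply: Order.POrderTheory.le_trans d2; apply: ereal_inf_lbound; exists p.
Qed.
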